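(* Let $M_t=0$ for all $t\in\mathbb{N}$ and $\delta=0$ in Algorithm 1 (described in the context), i.e. the approximation calculations are exact. Then for any $v^0\in\mathcal{V}$: (a) the sequence $\{v^t\}$ generated by $$v^{t+1}=\max_{d\in\mathcal{D}}\min_{P_d\in\mathcal{P}_d}\left\{Q_d^{-1}r_{(d,P_d)}+Q_d^{-1}R_d v^t\right\},$$ where $(Q_d,R_d)$ is the GS regular splitting of $I-\lambda P_d$, converges in norm to the robust team-optimal value function $v^*$ as $t\to\infty$; it converges globally at order $1$ at a rate no greater than $\lambda$; its global AARC is no greater than $\lambda$; and it is globally $O(\beta^t)$ for some $\beta\le\lambda$; (b) Algorithm 1 terminates within a finite number of iterations with an $\epsilon$-robust team-optimal policy $(d^\epsilon)^\infty$, and its corresponding value function $v^\epsilon:=\min_{P\in\mathcal{P}_{d^\epsilon}}v_{(d^\epsilon,P)}$ under the worst-case transition probability matrix satisfies $\|v^\epsilon-v^*\|<\epsilon$.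
   Context: **Game.** $\mathcal{N}=\{1,\dots,n\}$ is the set of players, $\mathcal{S}=\{s^1,\dots,s^m\}$ a finite state set, $\mathcal{A}=\mathcal{A}^1\times\cdots\times\mathcal{A}^n$ the set of joint actions, each $\mathcal{A}^i$ finite and nonempty. Payoffs $r^i:\mathcal{S}\times\mathcal{A}\times\mathcal{S}\to\mathbb{R}$ satisfy $|r^i|\le R_{\max}<\infty$; $r=\frac1n\sum_i r^i$ is the team-average payoff; $\lambda\in[0,1)$ is the discount factor. For each $a\in\mathcal{A}$ and $k\in\{1,\dots,m\}$, $\mathcal{P}_a(\cdot|k)$ is a finite nonempty set of probability distributions on $\mathcal{S}$ (the possible transition distributions from $s^k$ under $a$). A (team) decision rule is a map $d:\mathcal{S}\to\mathcal{A}$; $\mathcal{D}$ is the set of all of them; the stationary team policy using $d$ at every epoch is $(d)^\infty$. For $d\in\mathcal{D}$, $\mathcal{P}_d=\prod_{k=1}^m\mathcal{P}_{d(s^k)}(\cdot|k)$ is the set of $m\times m$ row-stochastic matrices whose $k$-th row lies in $\mathcal{P}_{d(s^k)}(\cdot|k)$ for each $k$. $P(l|k)$ denotes the entry of $P$ in row $k$, column $l$. For $d\in\mathcal{D}$, $P\in\mathcal{P}_d$: $r_{(d,P)}\in\mathbb{R}^m$ has $k$-th component $\sum_{l}r(s^k,d(s^k),s^l)P(l|k)$, and $v_{(d,P)}=(I-\lambda P)^{-1}r_{(d,P)}$. **Conventions.** $\mathbb{N}$ is the set of nonnegative integers. $\mathcal{V}$ is the space of real functions on $\mathcal{S}$ (identified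 with $\mathbb{R}^m$) with sup norm $\|v\|=\sup_s|v(s)|$; matrix norm $\|P\|=\max_k\sum_l|p_{kl}|$. Order, max and min of vectors and matrices are componentwise; $\mathbf{1}$ is the all-ones vector. The robust team-optimal value function is $v^*=\max_{d\in\mathcal{D}}\min_{P\in\mathcal{P}_d}v_{(d,P)}$. A policy $(d^\epsilon)^\infty$ is $\epsilon$-robust team-optimal ($\epsilon>0$) if $\min_{P\in\mathcal{P}_{d^\epsilon}}v_{(d^\epsilon,P)}\ge v^*-\epsilon\mathbf{1}$. **GS regular splitting.** For a transition matrix $P$ write $P=P^L+P^U$ with $P^L$ the strictly lower triangular part and $P^U$ the upper triangular part including the diagonal. The GS regular splitting of $I-\lambda P$ is $(Q,R)$ with $Q=I-\lambda P^L$, $R=\lambda P^U$. **Convergence rates.** A sequence $v^t\to v^*$ converges at order $c>0$ if there is a constant $L$ with $\|v^{t+1}-v^*\|\le L\|v^t-v^*\|^c$ for all $t\in\mathbb{N}$; its rate is the smallest such $L$. Its asymptotic average rate of convergence (AARC) is $\limsup_{t\to\infty}(\|v^t-v^*\|/\|v^0-v^*\|)^{1/t}$. It is $O(f(t))$ if $\limsup_{t\to\infty}\|v^t-v^*\|/f(t)$ is finite. Such a property is global if it holds for every $v^0\in\mathcal{V}$. **Algorithm 1 (raTPI).** Input: $v^0$, $\epsilon>0$, $\lambda\in[0,1)$, $\delta$ with $0\le\delta<\frac{(1-\lambda)^2\epsilon}{2\lambda(1+\lambda)}$, and nonnegative integers $\{M_t\}_{t\in\mathbb{N}}$. Start at $t=0$.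 Step 2 (policy improvement): for $k=1,\dots,m$ in order, for every $a\in\mathcal{A}$ compute $\tilde\rho_{(s^k,a)}(v^t)$ with $|\tilde\rho_{(s^k,a)}(v^t)-\rho_{(s^k,a)}(v^t)|\le\lambda\delta$, where $$\rho_{(s^k,a)}(v^t)=\min_{p\in\mathcal{P}_a(\cdot|k)}\Big\{\sum_{l=1}^m r(s^k,a,s^l)p(s^l)+\lambda\Big[\sum_{l<k}p(s^l)u_0^t(s^l)+\sum_{l\ge k}p(s^l)v^t_{s^l}\Big]\Big\};$$ set $u_0^t(s^k)=\max_a\tilde\rho_{(s^k,a)}(v^t)$ and choose $d_{t+1}(s^k)\in\arg\max_a\tilde\rho_{(s^k,a)}(v^t)$. Step 3 (partial policy evaluation): if $\|u_0^t-v^t\|<\frac{(1-\lambda)\epsilon}{2\lambda}-\delta$, stop and return $(d^\epsilon)^\infty$ with $d^\epsilon=d_{t+1}$. Otherwise, for $\varsigma=0,\dots,M_t-1$ and $k=1,\dots,m$ in order, with $a'=d_{t+1}(s^k)$, compute $\tilde\rho_{(s^k,a')}(u^t_\varsigma)$ with $|\tilde\rho_{(s^k,a')}(u^t_\varsigma)-\rho_{(s^k,a')}(u^t_\varsigma)|\le\lambda\delta$, where $$\rho_{(s^k,a')}(u^t_\varsigma)=\sum_{l}r(s^k,a',s^l)p^*(s^l)+\lambda\Big[\sum_{l<k}p^*(s^l)u^t_{\varsigma+1}(s^l)+\sum_{l\ge k}p^*(s^l)u^t_\varsigma(s^l)\Big]$$ and $p^*=p^*(\cdot|s^k,a')$ is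 the minimizing distribution used in Step 2 for $(s^k,a')$; set $u^t_{\varsigma+1}(s^k)=\tilde\rho_{(s^k,a')}(u^t_\varsigma)$. Then set $v^{t+1}=u^t_{M_t}$, increase $t$ by one and return to Step 2. When $\lambda=0$, the bounds with $\lambda$ in the denominator are read as $+\infty$. *)

(* Defs.v *)
From mathcomp Require Import all_boot all_order all_algebra.
From mathcomp Require Import all_classical all_reals all_analysis.

Set Implicit Arguments.
Unset Strict Implicit.
Unset Printing Implicit Defensive.

Import Order.TTheory GRing.Theory Num.Theory.
Import numFieldNormedType.Exports.

Local Open Scope classical_set_scope.
Local Open Scope ring_scope.

(* Conventions.  States are 'I_m, and real functions on states are column
   vectors 'cV[R]_m, whose library norm `|v| is the sup norm.  A distribution
   on states is a row vector, so that the k-th row of a transition matrix P is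
   the distribution P(.|k), and P k l is P(l|k). *)

Section Extrema.
Context {R : realType}.

(* Least and greatest elements.  [get] returns a junk value when there is none;
   they are meant for sets that do have one, such as nonempty finite sets. *)
Definition set_min (E : set R) : R := get (E `&` lbound E).
Definition set_max (E : set R) : R := get (E `&` ubound E).

Context {m : nat}.

Definition vmin (E : set 'cV[R]_m) : 'cV[R]_m :=
  \col_k set_min [set v k ord0 | v in E].
Definition vmax (E : set 'cV[R]_m) : 'cV[R]_m :=
  \col_k set_max [set v k ord0 | v in E].

End Extrema.

Definition is_distribution (R : realType) (m : nat) (p : 'rV[R]_m) : Prop :=
  (forall l, 0 <= p ord0 l) /\ \sum_l p ord0 l = 1.

Record robust_game (R : realType) (n m : nat) := RobustGame {
  players_gt0 : (0 < n)%N;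
  action : 'I_n -> finType;
  action_gt0 : forall i, (0 < #|action i|)%N;
  payoff : 'I_n -> 'I_m -> {dffun forall i, action i} -> 'I_m -> R;
  payoff_bounded : exists Rmax : R,
    forall i k a l, `|payoff i k a l| <= Rmax;
  discount : R;
  discount_ge0 : 0 <= discount;
  discount_lt1 : discount < 1;
  transitions : {dffun forall i, action i} -> 'I_m -> set 'rV[R]_m;
  transitions_finite : forall a k, finite_set (transitions a k);
  transitions_nonempty : forall a k, transitions a k !=set0;
  transitions_distribution :
    forall a k p, transitions a k p -> is_distribution p
}.

Section Game.
Context {R : realType} {n m : nat}.
Variable G : robust_game R n m.

Definition joint_action : Type := {dffun forall i, action G i}.

Definition decision_rule : Type := 'I_m -> joint_action.

Local Notation lambda := (discount G).

Definition team_payoff (k : 'I_m) (a : joint_action) (l : 'I_m) : R :=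
  n%:R^-1 * \sum_(i < n) payoff i k a l.

Definition transition_matrices (d : decision_rule) : set 'M[R]_m :=
  [set P | forall k, transitions (d k) k (row k P)].

Definition reward (d : decision_rule) (P : 'M[R]_m) : 'cV[R]_m :=
  \col_k \sum_l team_payoff k (d k) l * P k l.

Definition policy_value (d : decision_rule) (P : 'M[R]_m) : 'cV[R]_m :=
  invmx (1%:M - lambda *: P) *m reward d P.

Definition worst_value (d : decision_rule) : 'cV[R]_m :=
  vmin [set policy_value d P | P in transition_matrices d].

Definition robust_optimal_value : 'cV[R]_m :=
  vmax [set worst_value d | d in [set: decision_rule]].

Definition robust_team_optimal (epsilon : R) (d : decision_rule) : Prop :=
  forall k, robust_optimal_value k ord0 - epsilon <= worst_value d k ord0.

Definition strict_lower (P : 'M[R]_m) : 'M[R]_m :=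
  \matrix_(k, l) if (l < k)%N then P k l else 0.
Definition upper (P : 'M[R]_m) : 'M[R]_m :=
  \matrix_(k, l) if (k <= l)%N then P k l else 0.

Definition splitQ (P : 'M[R]_m) : 'M[R]_m := 1%:M - lambda *: strict_lower P.
Definition splitR (P : 'M[R]_m) : 'M[R]_m := lambda *: upper P.

Definition GS_operator (v : 'cV[R]_m) : 'cV[R]_m :=
  vmax [set vmin [set invmx (splitQ P) *m reward d P
                      + invmx (splitQ P) *m splitR P *m v
                 | P in transition_matrices d]
       | d in [set: decision_rule]].

Definition GS_sequence (v0 : 'cV[R]_m) (t : nat) : 'cV[R]_m :=
  iter t GS_operator v0.

(* One-state backup at state k: [u] supplies the already updated components
   l < k, and [v] the components l >= k. *)
Definition backup (k : 'I_m) (a : joint_action) (u v : 'cV[R]_m)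
    (p : 'rV[R]_m) : R :=
  \sum_l team_payoff k a l * p ord0 l
  + lambda * (\sum_(l < m | (l < k)%N) p ord0 l * u l ord0
              + \sum_(l < m | (k <= l)%N) p ord0 l * v l ord0).

Definition robust_backup (k : 'I_m) (a : joint_action) (u v : 'cV[R]_m) : R :=
  set_min [set backup k a u v p | p in transitions a k].

(* Step 2 at [v] may produce [u0], the decision rule [d] and, for each state
   and joint action, the minimizing distribution [pstar].  The equations
   determine u0 in the order of the states, as rho~ at k involves u0 only at
   l < k; arbitrary approximations within the tolerance, argmax choices and
   minimizers are allowed. *)
Definition policy_improvement (delta : R) (v u0 : 'cV[R]_m)
    (d : decision_rule) (pstar : 'I_m -> joint_action -> 'rV[R]_m) : Prop :=
  exists rho : 'I_m -> joint_action -> R,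
    [/\ forall k a, `|rho k a - robust_backup k a u0 v| <= lambda * delta,
        forall k a, transitions a k (pstar k a) /\
                    backup k a u0 v (pstar k a) = robust_backup k a u0 v,
        forall k, u0 k ord0 = set_max [set rho k a | a in [set: joint_action]]
      & forall k a, rho k a <= rho k (d k)].

(* Extended-real division, for which x / 0 = +oo if x > 0: with discount 0 the
   threshold is +oo. *)
Definition stopping_test (epsilon delta : R) (v u0 : 'cV[R]_m) : Prop :=
  (`|u0 - v|%:E <
     ((1 - lambda) * epsilon)%:E / (2 * lambda)%:E - delta%:E)%E.

Definition partial_evaluation (delta : R) (M : nat) (d : decision_rule)
    (pstar : 'I_m -> joint_action -> 'rV[R]_m) (u : nat -> 'cV[R]_m) : Prop :=
  forall j : nat, (j < M)%N -> forall k : 'I_m,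
    `|u j.+1 k ord0 - backup k (d k) (u j.+1) (u j) (pstar k (d k))|
      <= lambda * delta.

(* Same convention on x / 0 as for the stopping test. *)
Definition admissible_tolerance (epsilon delta : R) : Prop :=
  0 <= delta /\
  (delta%:E < ((1 - lambda) ^+ 2 * epsilon)%:E
                / (2 * lambda * (1 + lambda))%:E)%E.

Inductive raTPI_state :=
  | Iterate of 'cV[R]_m
  | Returned of decision_rule.

Inductive raTPI_step (epsilon delta : R) (M : nat -> nat) (t : nat) :
    raTPI_state -> raTPI_state -> Prop :=
  | raTPI_stop v u0 d pstar :
      policy_improvement delta v u0 d pstar ->
      stopping_test epsilon delta v u0 ->
      raTPI_step epsilon delta M t (Iterate v) (Returned d)
  | raTPI_continue v u0 d pstar u :
      policy_improvement delta v u0 d pstar ->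
      ~ stopping_test epsilon delta v u0 ->
      u 0%N = u0 ->
      partial_evaluation delta (M t) d pstar u ->
      raTPI_step epsilon delta M t (Iterate v) (Iterate (u (M t)))
  | raTPI_halted d :
      raTPI_step epsilon delta M t (Returned d) (Returned d).

(* A run carries v^t while the algorithm has not stopped, then the returned
   decision rule forever. *)
Definition raTPI_run (epsilon delta : R) (M : nat -> nat) (v0 : 'cV[R]_m)
    (x : nat -> raTPI_state) : Prop :=
  x 0%N = Iterate v0 /\
  forall t, raTPI_step epsilon delta M t (x t) (x t.+1).

End Game.

Section ConvergenceRates.
Context {R : realType} {m : nat}.
Implicit Types (u : nat -> 'cV[R]_m) (l : 'cV[R]_m).

(* Constants are taken nonnegative, which matters only for the sequence
   constantly equal to l: otherwise all constants are nonnegative anyway. *)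
Definition order_constants (c : R) u l : set R :=
  [set L | 0 <= L /\ forall t, `|u t.+1 - l| <= L * `|u t - l| `^ c].

Definition converges_at_order (c : R) u l : Prop :=
  [/\ 0 < c, u @ \oo --> l & order_constants c u l !=set0].

Definition convergence_rate (c : R) u l : R := set_min (order_constants c u l).

(* The asymptotic average rate of convergence.  If u 0 = l then the quotient
   0 / 0 is 0. *)
Definition AARC u l : \bar R :=
  limn_esup (fun t => ((`|u t - l| / `|u 0%N - l|) `^ (t%:R^-1))%:E).

(* Extended-real quotient: x / 0 is +oo if x > 0, and 0 / 0 is 0. *)
Definition is_bigO u l (f : nat -> R) : Prop :=
  limn_esup (fun t => (`|u t - l|%:E / (f t)%:E)%E) \is a fin_num.

End ConvergenceRates.

(* Main.v *)
(* Every Bellman-type map [H] here satisfies [u <= u' + c -> H u <= H u' +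
   lambda c] for [c >= 0]; this property passes to minima and maxima.  It makes
   [H] a lambda-contraction and yields the comparison principle [u <= H u,
   H u' <= u' -> u <= u'].  Hence the componentwise minimum (maximum) of the
   fixed points of a family of such maps is the fixed point of the minimized
   (maximized) map, whenever a single member attains the extremum at that
   point.  Applied to policy values this gives the Bellman equations of v^* and
   of the worst-case value of a decision rule; applied to the sweeps at a fixed
   v it identifies the GS operator with the sequential update of the algorithm.
   All rates follow from the contraction of the sweep, and if u0 is the sweep of
   v with greedy rule d, then both the worst-case value of d and v^* are within
   lambda / (1 - lambda) * |u0 - v| of u0. *)

From HB Require Import structures.
Require Import Defs.
From mathcomp Require Import all_boot all_order all_algebra.
From mathcomp Require Import all_classical all_reals all_analysis.
From mathcomp Require Import ring lra.

Set Implicit Arguments.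
Unset Strict Implicit.
Unset Printing Implicit Defensive.

Import Order.TTheory GRing.Theory Num.Theory.
Import numFieldNormedType.Exports.

Local Open Scope classical_set_scope.
Local Open Scope ring_scope.

(* Matrices are complete and normed in the library, but the join of the two
   structures is not declared there; Banach's fixed-point theorem needs it. *)
HB.instance Definition _ (R : realType) (m n : nat) :=
  Complete.on 'M[R]_(m, n).

(** * Minima and maxima of finite sets of reals *)

Section FiniteExtrema.
Context {R : realType}.
Implicit Types (E : set R) (x y c : R).

Lemma finite_has_min E :
  finite_set E -> E !=set0 -> exists x, (E `&` lbound E) x.
Proof.
move=> /finite_seqP[s ->] {E}; elim: s => [[x]//|x s IHs] _.
have [s0|[y [ys ylb]]] : s = [::] \/ exists y, ([set` s] `&` lbound [set` s]) y.
  case: s IHs => [|y s] IHs; first by left.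
  by right; apply: IHs; exists y; rewrite /= inE eqxx.
  exists x; rewrite s0; split; first by rewrite /= inE.
  by move=> z /=; rewrite inE => /eqP->.
exists (Num.min x y); split=> [|z] /=.
  by rewrite minEle; case: ifP => _; rewrite inE ?eqxx // ys orbT.
by rewrite inE ge_min => /predU1P[->|/ylb->]; rewrite ?lexx ?orbT.
Qed.

Lemma set_minP E :
  finite_set E -> E !=set0 -> (E `&` lbound E) (set_min E).
Proof. by move=> Efin E0; apply: getPex; exact: finite_has_min. Qed.

Lemma set_maxP E :
  finite_set E -> E !=set0 -> (E `&` ubound E) (set_max E).
Proof.
move=> Efin [y Ey]; apply: getPex.
have [x [[z Ez <-] zmin]] : exists x, ([set - z | z in E] `&`
    lbound [set - z | z in E]) x.
  by apply: finite_has_min; [exact: finite_image|exists (- y), y].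
by exists z; split=> // t Et; rewrite -lerN2; apply: zmin; exists t.
Qed.

Lemma set_min_eq E x : E x -> lbound E x -> set_min E = x.
Proof.
move=> Ex xlb; apply: get_unique => // y [Ey ylb].
by apply/eqP; rewrite eq_le ylb //= xlb.
Qed.

Lemma set_max_eq E x : E x -> ubound E x -> set_max E = x.
Proof.
move=> Ex xub; apply: get_unique => // y [Ey yub].
by apply/eqP; rewrite eq_le yub //= xub.
Qed.

Lemma set_min_le_add (T : Type) (A : set T) (f g : T -> R) c :
  finite_set A -> A !=set0 -> (forall p, A p -> f p <= g p + c) ->
  set_min [set f p | p in A] <= set_min [set g p | p in A] + c.
Proof.
move=> Afin [p0 Ap0] fg.
have fP := set_minP (finite_image f Afin) (image_nonempty f (ex_intro _ p0 Ap0)).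
have [[p Ap <-] _] :=
  set_minP (finite_image g Afin) (image_nonempty g (ex_intro _ p0 Ap0)).
by apply: le_trans (fg p Ap); apply: fP.2; exists p.
Qed.

Lemma set_max_le_add (T : Type) (A : set T) (f g : T -> R) c :
  finite_set A -> A !=set0 -> (forall p, A p -> f p <= g p + c) ->
  set_max [set f p | p in A] <= set_max [set g p | p in A] + c.
Proof.
move=> Afin [p0 Ap0] fg.
have [[p Ap <-] _] :=
  set_maxP (finite_image f Afin) (image_nonempty f (ex_intro _ p0 Ap0)).
have gP := set_maxP (finite_image g Afin) (image_nonempty g (ex_intro _ p0 Ap0)).
by apply: le_trans (fg p Ap) _; rewrite lerD2r; apply: gP.2; exists p.
Qed.

End FiniteExtrema.

(** * The sup norm and componentwise bounds *)

Section SupNorm.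
Context {R : realType} {m : nat}.
Implicit Types (u v : 'cV[R]_m) (c : R).

Lemma cV_norm_le v c :
  0 <= c -> (forall k, `|v k ord0| <= c) -> `|v| <= c.
Proof.
move=> c0 vc; rewrite [leLHS]/Num.norm /= mx_normrE.
by apply: bigmax_le => // -[k j] _ /=; rewrite (ord1 j).
Qed.

Lemma le_cV_norm v k : `|v k ord0| <= `|v|.
Proof.
rewrite [leRHS]/Num.norm /= mx_normrE.
exact: (le_bigmax _ (fun ij => `|v ij.1 ij.2|) (k, ord0)).
Qed.

Lemma le_coord_dist u v k : u k ord0 <= v k ord0 + `|u - v|.
Proof.
rewrite -lerBlDl; apply: le_trans (le_cV_norm _ k).
by rewrite !mxE ler_norm.
Qed.

End SupNorm.

(** * Comparison, contraction and extrema of fixed points of discounted maps *)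

Section Discounted.
Context {R : realType} {m : nat}.
Variable lambda : R.
Hypotheses (lambda_ge0 : 0 <= lambda) (lambda_lt1 : lambda < 1).
Implicit Types (u v w : 'cV[R]_m) (c : R).

Definition le_upto c u v := forall k, u k ord0 <= v k ord0 + c.

(* A one-sided bound, which gives monotonicity at [c = 0] and the contraction
   property when [c] is the distance of the arguments. *)
Definition discounted (H : 'I_m -> 'cV[R]_m -> R) :=
  forall u u' c, 0 <= c -> le_upto c u u' ->
    forall k, H k u <= H k u' + lambda * c.

(** In a sweep, the first vector is the one being computed and the second is the previous
    iterate. *)
Definition discounted2 (F : 'I_m -> 'cV[R]_m -> 'cV[R]_m -> R) :=
  forall u u' v v' c, 0 <= c -> le_upto c u u' -> le_upto c v v' ->
    forall k, F k u v <= F k u' v' + lambda * c.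

Definition nonexpansive (phi : 'cV[R]_m -> 'cV[R]_m) :=
  forall u u' c, 0 <= c -> le_upto c u u' -> le_upto c (phi u) (phi u').

Definition fixpoint (H : 'I_m -> 'cV[R]_m -> R) u :=
  forall k, u k ord0 = H k u.

Lemma nonexpansive_id : nonexpansive id.
Proof. by []. Qed.

Lemma nonexpansive_cst v : nonexpansive (fun=> v).
Proof. by move=> u u' c c0 _ k; rewrite lerDl. Qed.

Lemma discounted2_comp F phi :
  discounted2 F -> nonexpansive phi -> discounted (fun k u => F k u (phi u)).
Proof. by move=> dF phiP u u' c c0 uu' k; apply: dF => //; exact: phiP. Qed.

(** The positive part [z] of [u - u'] satisfies [|z| <= lambda * |z|], hence vanishes. *)
Lemma le_fixpoint H u u' :
  discounted H -> (forall k, u k ord0 <= H k u) ->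
  (forall k, H k u' <= u' k ord0) -> forall k, u k ord0 <= u' k ord0.
Proof.
move=> dH uH Hu'.
pose z : 'cV[R]_m := \col_k Num.max 0 (u k ord0 - u' k ord0).
have zge k : u k ord0 - u' k ord0 <= z k ord0 by rewrite mxE le_max lexx orbT.
have z0 k : 0 <= z k ord0 by rewrite mxE le_max lexx.
have uu' : le_upto `|z| u u'.
  move=> k; rewrite -lerBlDl (le_trans (zge k))//.
  by rewrite -[leLHS](ger0_norm (z0 k)) le_cV_norm.
have zle : `|z| <= lambda * `|z|.
  apply: cV_norm_le => [|k]; first by rewrite mulr_ge0.
  rewrite ger0_norm // mxE ge_max mulr_ge0 //= lerBlDl.
  apply: le_trans (uH k) _; apply: le_trans (dH _ _ _ (normr_ge0 z) uu' k) _.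
  by rewrite lerD2r.
have {}z00 : `|z| = 0.
  apply/eqP; rewrite eq_le normr_ge0 andbT.
  by rewrite -(pmulr_rle0 _ (_ : 0 < 1 - lambda)) ?subr_gt0 // mulrBl; lra.
by move=> k; have := uu' k; rewrite z00 addr0.
Qed.

Lemma fixpoint_unique H u u' :
  discounted H -> fixpoint H u -> fixpoint H u' -> u = u'.
Proof.
move=> dH uH u'H; apply/colP => k; apply/eqP; rewrite eq_le.
by rewrite !(@le_fixpoint H) // => j; rewrite -?uH -?u'H.
Qed.

Lemma discounted_dist H u v :
  discounted H -> `|\col_k H k u - \col_k H k v| <= lambda * `|u - v|.
Proof.
move=> dH; apply: cV_norm_le => [|k]; first by rewrite mulr_ge0.
have Huv := dH _ _ _ (normr_ge0 (u - v)) (le_coord_dist u v) k.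
have Hvu := dH _ _ _ (normr_ge0 (v - u)) (le_coord_dist v u) k.
rewrite !mxE ler_norml; apply/andP; split; last by lra.
by rewrite (distrC v u) in Hvu; lra.
Qed.

Lemma fixpoint_exists H : discounted H -> exists u, fixpoint H u.
Proof.
move=> dH; pose T u : 'cV[R]_m := \col_k H k u.
have TP : {homo T : u / [set: 'cV[R]_m] u >-> [set: 'cV[R]_m] u} by [].
have ctr : is_contraction (mkfun TP).
  exists (NngNum lambda_ge0); split=> // -[u v] _ /=.
  exact: discounted_dist.
have [|u _ uT] := banach_fixed_point ctr closedT; first by exists 0.
by exists u => k; rewrite {1}uT mxE.
Qed.

(** A sweep defines its output only implicitly. With [c] the larger of the two distances, the
    outputs differ by at most [lambda * c]. If [c] were the output distance and exceeded [|v - v'|],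
    it would have to be 0, a contradiction. *)
Lemma fixpoint_dist F u u' v v' : discounted2 F ->
  fixpoint (fun k w => F k w v) u -> fixpoint (fun k w => F k w v') u' ->
  `|u - u'| <= lambda * `|v - v'|.
Proof.
move=> dF uF u'F; set c := Num.max `|u - u'| `|v - v'|.
have c0 : 0 <= c by rewrite le_max normr_ge0.
have up (w w' : 'cV[R]_m) : `|w - w'| <= c -> le_upto c w w'.
  by move=> wc k; apply: le_trans (le_coord_dist w w' k) _; rewrite lerD2l.
have cu : `|u - u'| <= c by rewrite le_max lexx.
have cv : `|v - v'| <= c by rewrite le_max lexx orbT.
have uc : `|u - u'| <= lambda * c.
  apply: cV_norm_le => [|k]; first by rewrite mulr_ge0.
  have := dF _ _ _ _ _ c0 (up _ _ cu) (up _ _ cv) k.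
  rewrite distrC in cu; rewrite distrC in cv.
  have := dF _ _ _ _ _ c0 (up _ _ cu) (up _ _ cv) k.
  rewrite -uF -u'F !mxE ler_norml => h1 h2.
  by apply/andP; split; lra.
move: uc; rewrite /c; case: (leP `|u - u'| `|v - v'|) => // vu uc.
suff : `|u - u'| <= 0 by move=> u0; have := normr_ge0 (v - v'); lra.
by rewrite -(pmulr_rle0 _ (_ : 0 < 1 - lambda)) ?subr_gt0 // mulrBl; lra.
Qed.

(** Let [w] be the fixed point of [Hmin]. A member attaining the minimum at [w] has [w] as its fixed
    point, and [w = Hmin w <= K j w] puts every [W j] above [w]. One member thus realizes all
    componentwise minima at once. *)
Lemma vmin_fixpoint (I : Type) (D : set I) Hmin (K : I -> _) (W : I -> _) :
  discounted Hmin -> (forall i, D i -> discounted (K i)) ->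
  (forall i, D i -> fixpoint (K i) (W i)) ->
  (forall i k u, D i -> Hmin k u <= K i k u) ->
  (forall u, exists2 i, D i & forall k, K i k u = Hmin k u) ->
  fixpoint Hmin (vmin [set W i | i in D]).
Proof.
move=> dH dK WK HK attain; have [w wH] := fixpoint_exists dH.
suff -> : vmin [set W i | i in D] = w by [].
have [i Di Ki] := attain w.
have Wi : W i = w.
  by apply: (fixpoint_unique (dK i Di) (WK i Di)) => k; rewrite Ki.
apply/colP => k; rewrite mxE; apply: set_min_eq.
  by exists (W i); [exists i|rewrite Wi].
move=> _ [_ [j Dj <-] <-]; move: k; apply: (le_fixpoint (dK j Dj)) => k.
  by rewrite wH HK.
by rewrite (WK j Dj).
Qed.

(** The dual argument; the comparison now runs through [Hmax], for which every [W j] is a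
    subsolution. *)
Lemma vmax_fixpoint (I : Type) (D : set I) Hmax (K : I -> _) (W : I -> _) :
  discounted Hmax -> (forall i, D i -> discounted (K i)) ->
  (forall i, D i -> fixpoint (K i) (W i)) ->
  (forall i k u, D i -> K i k u <= Hmax k u) ->
  (forall u, exists2 i, D i & forall k, K i k u = Hmax k u) ->
  fixpoint Hmax (vmax [set W i | i in D]).
Proof.
move=> dH dK WK HK attain; have [w wH] := fixpoint_exists dH.
suff -> : vmax [set W i | i in D] = w by [].
have [i Di Ki] := attain w.
have Wi : W i = w.
  by apply: (fixpoint_unique (dK i Di) (WK i Di)) => k; rewrite Ki.
apply/colP => k; rewrite mxE; apply: set_max_eq.
  by exists (W i); [exists i|rewrite Wi].
move=> _ [_ [j Dj <-] <-]; move: k; apply: (le_fixpoint dH) => k.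
  by rewrite (WK j Dj) HK.
by rewrite wH.
Qed.

(** A kernel vector is a fixed point of [x |-> lambda B x], as is 0, so uniqueness applies. Rows may
    sum to less than 1, which covers both [I - lambda P] and the factor [Q] of the splitting. *)
Lemma discounted_unitmx (B : 'M[R]_m) :
  (forall k l, 0 <= B k l) -> (forall k, \sum_l B k l <= 1) ->
  1%:M - lambda *: B \in unitmx.
Proof.
move=> B0 B1; rewrite -unitmx_tr -row_free_unit; apply: inj_row_free => x.
move=> /(congr1 trmx); rewrite trmx_mul trmxK trmx0 mulmxBl mul1mx -scalemxAl.
move=> /subr0_eq xB; rewrite -[x]trmxK -[RHS]trmx0; congr trmx.
pose H k (u : 'cV[R]_m) := lambda * \sum_l B k l * u l ord0.
have dH : discounted H.
  move=> u u' c c0 uu' k; rewrite /H -mulrDr ler_wpM2l //.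
  (* The mass missing from row [k] leaves a nonnegative slack. *)
  have -> : \sum_l B k l * u' l ord0 + c =
      \sum_l B k l * (u' l ord0 + c) + (1 - \sum_l B k l) * c.
    under [in RHS]eq_bigr do rewrite mulrDr.
    by rewrite big_split /= -mulr_suml; ring.
  rewrite -[leLHS]addr0 lerD //; last by rewrite mulr_ge0 ?subr_ge0.
  by apply: ler_sum => l _; rewrite ler_wpM2l.
apply: (fixpoint_unique dH) => k; first by rewrite {1}xB !mxE.
by rewrite /H mxE big1 ?mulr0 // => l _; rewrite mxE mulr0.
Qed.

End Discounted.

(** * Bellman equations and the Gauss-Seidel operator *)

Section RobustBackups.
Context {R : realType} {n m : nat}.
Variable G : robust_game R n m.

Local Notation lambda := (discount G).
Local Notation discounted2 := (discounted2 lambda).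

Implicit Types (d : decision_rule G) (P : 'M[R]_m) (u v w : 'cV[R]_m).

Let lambda_ge0 := discount_ge0 G.
Let lambda_lt1 := discount_lt1 G.

Definition optimal_backup k u v : R :=
  set_max [set robust_backup k a u v | a in [set: joint_action G]].

Lemma joint_actions_finite : finite_set [set: joint_action G].
Proof. exact: (@finite_finset {dffun forall i, action G i}). Qed.

Lemma joint_actions_nonempty : [set: joint_action G] !=set0.
Proof.
have a0 i : action G i by case/card_gt0P/sigW: (action_gt0 G i).
by exists ([ffun i => a0 i] : {dffun forall i, action G i}).
Qed.

Lemma robust_backup_attained k (a : joint_action G) u v :
  exists2 p, transitions a k p & backup k a u v p = robust_backup k a u v.
Proof.
have [] := set_minP (finite_image (backup k a u v) (transitions_finite a k))
                    (image_nonempty _ (transitions_nonempty a k)).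
by case=> p ap pmin _; exists p.
Qed.

Lemma robust_backup_le k (a : joint_action G) u v p :
  transitions a k p -> robust_backup k a u v <= backup k a u v p.
Proof.
move=> ap.
have [_] := set_minP (finite_image (backup k a u v) (transitions_finite a k))
                     (image_nonempty _ (transitions_nonempty a k)).
by apply; exists p.
Qed.

Lemma optimal_backup_attained k u v :
  exists a : joint_action G, robust_backup k a u v = optimal_backup k u v.
Proof.
have [] := set_maxP
  (finite_image (fun a => robust_backup k a u v) joint_actions_finite)
  (image_nonempty _ joint_actions_nonempty).
by case=> a _ amax _; exists a.
Qed.

Lemma le_optimal_backup k (a : joint_action G) u v :
  robust_backup k a u v <= optimal_backup k u v.
Proof.
have [_] := set_maxP
  (finite_image (fun a => robust_backup k a u v) joint_actions_finite)
  (image_nonempty _ joint_actions_nonempty).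
by apply; exists a.
Qed.

Lemma backup_le_add k (a : joint_action G) u u' v v' c p :
  0 <= c -> le_upto c u u' -> le_upto c v v' -> is_distribution p ->
  backup k a u v p <= backup k a u' v' p + lambda * c.
Proof.
move=> c0 uu' vv' [p0 p1].
rewrite /backup -addrA lerD2l -mulrDr ler_wpM2l //.
(* As [p] has total mass 1, [c] is its own average, split between updated and old components. *)
have -> : c = \sum_(l < m | (l < k)%N) p ord0 l * c
            + \sum_(l < m | (k <= l)%N) p ord0 l * c.
  rewrite -!mulr_suml -mulrDl -[LHS]mul1r -p1 (bigID (fun l : 'I_m => (l < k)%N)).
  by congr ((_ + _) * c); apply: eq_bigl => l /=; rewrite -leqNgt.
rewrite addrACA -!big_split /=; apply: lerD; apply: ler_sum => l _.
  by rewrite -mulrDr ler_wpM2l.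
by rewrite -mulrDr ler_wpM2l.
Qed.

Lemma discounted_backup d P :
  transition_matrices d P ->
  discounted2 (fun k u v => backup k (d k) u v (row k P)).
Proof.
move=> dP u u' v v' c c0 uu' vv' k; apply: backup_le_add => //.
exact: transitions_distribution (dP k).
Qed.

Lemma robust_backup_le_add k (a : joint_action G) u u' v v' c :
  0 <= c -> le_upto c u u' -> le_upto c v v' ->
  robust_backup k a u v <= robust_backup k a u' v' + lambda * c.
Proof.
move=> c0 uu' vv'; apply: set_min_le_add => [||p ap].
- exact: transitions_finite.
- exact: transitions_nonempty.
- by apply: backup_le_add => //; exact: transitions_distribution ap.
Qed.

Lemma discounted_robust_backup d :
  discounted2 (fun k u v => robust_backup k (d k) u v).
Proof. by move=> u u' v v' c c0 uu' vv' k; exact: robust_backup_le_add. Qed.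

Lemma discounted_optimal_backup : discounted2 optimal_backup.
Proof.
move=> u u' v v' c c0 uu' vv' k; apply: set_max_le_add => [||a _].
- exact: joint_actions_finite.
- exact: joint_actions_nonempty.
- exact: robust_backup_le_add.
Qed.

(* [phi = id] covers the values of stationary policies, and a constant [phi]
   one Gauss-Seidel sweep. *)
Lemma vmin_robust_fixpoint phi (V : 'M[R]_m -> 'cV[R]_m) d :
  nonexpansive phi ->
  (forall P, transition_matrices d P ->
    fixpoint (fun k u => backup k (d k) u (phi u) (row k P)) (V P)) ->
  fixpoint (fun k u => robust_backup k (d k) u (phi u))
           (vmin [set V P | P in transition_matrices d]).
Proof.
move=> phiP VP; apply: (vmin_fixpoint lambda_ge0 lambda_lt1 _ _ VP).
- exact: discounted2_comp (discounted_robust_backup d) phiP.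
- by move=> P dP; exact: discounted2_comp (discounted_backup dP) phiP.
- by move=> P k u dP; apply: robust_backup_le; exact: dP.
(* The rows of a transition matrix are chosen independently, so rowwise minimizers assemble into one
   admissible matrix. *)
- move=> u; have /choice[p pP] k : exists p, transitions (d k) k p /\
      backup k (d k) u (phi u) p = robust_backup k (d k) u (phi u).
    by have [p] := robust_backup_attained k (d k) u (phi u); exists p.
  by exists (\matrix_k p k) => k; rewrite rowK; have [] := pP k.
Qed.

Lemma vmax_optimal_fixpoint phi (V : decision_rule G -> 'cV[R]_m) :
  nonexpansive phi ->
  (forall d, fixpoint (fun k u => robust_backup k (d k) u (phi u)) (V d)) ->
  fixpoint (fun k u => optimal_backup k u (phi u))
           (vmax [set V d | d in [set: decision_rule G]]).
Proof.
move=> phiP VP.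
apply: (vmax_fixpoint lambda_ge0 lambda_lt1 _ _ (fun d _ => VP d)).
- exact: discounted2_comp discounted_optimal_backup phiP.
- by move=> d _; exact: discounted2_comp (discounted_robust_backup d) phiP.
- by move=> d k u _; exact: le_optimal_backup.
(* Likewise, statewise maximizing actions form one decision rule. *)
- move=> u; have /choice[d dP] k := optimal_backup_attained k u (phi u).
  by exists d.
Qed.

(** Row [k] of [(I - lambda P) w = r], with the sum over states cut at [k]. *)
Lemma policy_value_fixpoint d P : transition_matrices d P ->
  fixpoint (fun k u => backup k (d k) u u (row k P)) (policy_value d P).
Proof.
move=> dP k; have Pdist j := transitions_distribution (dP j).
have unitA : 1%:M - lambda *: P \in unitmx.
  apply: discounted_unitmx => // j; [move=> l|].
    by have := (Pdist j).1 l; rewrite mxE.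
  by rewrite -(Pdist j).2; apply: ler_sum => l _; rewrite mxE.
have /colP/(_ k) := mulKVmx unitA (reward d P).
rewrite -/(policy_value d P); set w := policy_value d P.
rewrite mulmxBl mul1mx -scalemxAl !mxE => /eqP; rewrite subr_eq => /eqP ->.
rewrite /backup; congr (_ + lambda * _).
  by apply: eq_bigr => l _; rewrite mxE.
rewrite (bigID (fun l : 'I_m => (l < k)%N)) /=.
by congr (_ + _); apply: eq_big => l; rewrite ?mxE // -leqNgt.
Qed.

(** Multiplication by [Q] turns the formula into [w = r + lambda P^L w + lambda P^U v], which is the
    sequential update written as an implicit equation. *)
Lemma splitting_fixpoint d P v : transition_matrices d P ->
  fixpoint (fun k u => backup k (d k) u v (row k P))
    (invmx (splitQ G P) *m reward d P + invmx (splitQ G P) *m splitR G P *m v).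
Proof.
move=> dP k; have Pdist j := transitions_distribution (dP j).
have unitQ : splitQ G P \in unitmx.
  apply: discounted_unitmx => // j; [move=> l|].
    by rewrite mxE; case: ifP => // _; have := (Pdist j).1 l; rewrite mxE.
  rewrite -(Pdist j).2; apply: ler_sum => l _; rewrite !mxE.
  by case: ifP => // _; have := (Pdist j).1 l; rewrite mxE.
rewrite -mulmxA -mulmxDr; set w := invmx _ *m _.
have /colP/(_ k) := mulKVmx unitQ (reward d P + splitR G P *m v).
rewrite -/w {1}/splitQ mulmxBl mul1mx -scalemxAl !mxE => /eqP.
rewrite subr_eq => /eqP ->.
rewrite -addrA; congr (_ + _); first by apply: eq_bigr => l _; rewrite mxE.
rewrite addrC mulrDr; congr (_ + _).
  congr (lambda * _); rewrite [RHS]big_mkcond /=; apply: eq_bigr => l _.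
  by rewrite !mxE; case: ifP => // _; rewrite mul0r.
rewrite mulr_sumr [RHS]big_mkcond /=; apply: eq_bigr => l _.
by rewrite !mxE; case: ifP => _; rewrite ?mulr0 ?mul0r // mulrA.
Qed.

Lemma worst_value_fixpoint d :
  fixpoint (fun k u => robust_backup k (d k) u u) (worst_value d).
Proof.
exact: (vmin_robust_fixpoint nonexpansive_id (@policy_value_fixpoint d)).
Qed.

Lemma robust_optimal_value_fixpoint :
  fixpoint (fun k u => optimal_backup k u u) (robust_optimal_value G).
Proof.
exact: (vmax_optimal_fixpoint nonexpansive_id worst_value_fixpoint).
Qed.

Lemma GS_operator_fixpoint v :
  fixpoint (fun k u => optimal_backup k u v) (GS_operator G v).
Proof.
have phiP := @nonexpansive_cst R m v.
apply: (vmax_optimal_fixpoint phiP) => d.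
by apply: (vmin_robust_fixpoint phiP) => P; exact: splitting_fixpoint.
Qed.

(** Identifies the vector produced state by state in policy improvement with the operator defined
    through splittings. *)
Lemma eq_GS_operator u v :
  fixpoint (fun k w => optimal_backup k w v) u -> u = GS_operator G v.
Proof.
move=> uP; apply: (fixpoint_unique lambda_ge0 lambda_lt1 _ uP) => //.
  exact: discounted2_comp discounted_optimal_backup (nonexpansive_cst v).
exact: GS_operator_fixpoint.
Qed.

(** The optimal value is its own sweep, so both vectors solve the same implicit equation, with old
    iterates [v] and [v^*]. *)
Lemma GS_operator_dist v :
  `|GS_operator G v - robust_optimal_value G|
    <= lambda * `|v - robust_optimal_value G|.
Proof.
apply: (fixpoint_dist lambda_ge0 lambda_lt1 discounted_optimal_backup).
  exact: GS_operator_fixpoint.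
exact: robust_optimal_value_fixpoint.
Qed.

Lemma GS_sequence_dist v0 t :
  `|GS_sequence G v0 t - robust_optimal_value G|
    <= lambda ^+ t * `|v0 - robust_optimal_value G|.
Proof.
elim: t => [|t IHt]; first by rewrite mul1r.
apply: le_trans (GS_operator_dist _) _.
by rewrite exprS -mulrA ler_wpM2l.
Qed.

Lemma GS_sequence_cvg v0 : GS_sequence G v0 @ \oo --> robust_optimal_value G.
Proof.
apply/cvgrPdist_le => e e0.
have := @cvg_geometric R `|v0 - robust_optimal_value G| lambda.
rewrite ger0_norm // => /(_ lambda_lt1)/cvgrPdist_le/(_ e e0).
apply: filterS => t; rewrite sub0r normrN; apply: le_trans.
rewrite distrC; apply: le_trans (GS_sequence_dist v0 t) _.
by rewrite mulrC ler_norm.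
Qed.

End RobustBackups.

(** * Bounds on limits superior *)

Section LimitSuperior.
Context {R : realType}.
Local Open Scope ereal_scope.

Lemma limn_esup_le (u : (\bar R)^nat) l N :
  (forall t, (N <= t)%N -> u t <= l) -> limn_esup u <= l.
Proof.
move=> ul; apply: (@le_trans _ _ (ereal_sup [set u t | t in [set t | (N <= t)%N]])).
  by apply: ereal_inf_lbound; exists [set t | (N <= t)%N] => //; exists N.
by apply: ge_ereal_sup => _ [t Nt <-]; exact: ul.
Qed.

Lemma limn_esup_ge (u : (\bar R)^nat) l :
  (forall t, l <= u t) -> l <= limn_esup u.
Proof.
move=> lu; apply: le_ereal_inf_tmp => _ [A [N _ NA] <-].
apply: le_trans (lu N) _; apply: ereal_sup_ubound; exists N => //.
by apply: NA => /=.
Qed.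

End LimitSuperior.

(** * Rates implied by geometric error bounds *)

Section Rates.
Context {R : realType} {m : nat}.
Implicit Types (u : nat -> 'cV[R]_m) (l : 'cV[R]_m).

(** The admissible constants form a closed set bounded below, so the infimum is attained and
    [set_min] is not a junk value. *)
Lemma convergence_rate_le c u l L :
  order_constants c u l L -> convergence_rate c u l <= L.
Proof.
move=> LP; set S := order_constants c u l.
have S0 : S !=set0 by exists L.
have lb0 : lbound S 0 by move=> x [].
have infS : S (inf S).
  split=> [|t]; first exact: lb_le_inf.
  (* If the power is 0, the inequality does not depend on the constant; otherwise it is a lower
     bound on the constant and passes to the infimum. *)
  have := powR_ge0 `|u t - l| c; rewrite le_eqVlt => /predU1P[e0|gt0].
    by have := LP.2 t; rewrite -e0 !mulr0.
  rewrite -ler_pdivrMr //; apply: lb_le_inf => // x [_ xP].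
  by rewrite ler_pdivrMr.
have infS_lb : lbound S (inf S) by apply: ge_inf; exists 0.
by rewrite /convergence_rate (set_min_eq infS infS_lb); exact: infS_lb.
Qed.

Lemma AARC_le u l (b : R) : 0 <= b ->
  (forall t, `|u t - l| <= b ^+ t * `|u 0%N - l|) -> (AARC u l <= b%:E)%E.
Proof.
(* The term at [t = 0] is excluded: there the exponent [0^-1] is 0 and the power is 1, which may
   exceed [b]. *)
move=> b0 ub; apply: (@limn_esup_le _ _ _ 1) => t t0; rewrite lee_fin.
have tR : t%:R != 0 :> R by rewrite pnatr_eq0 -lt0n.
have bE : b = (b ^+ t) `^ t%:R^-1.
  by rewrite -powR_mulrn // -powRrM mulfV // powRr1.
rewrite [leRHS]bE; apply: ge0_ler_powR; rewrite ?nnegrE ?invr_ge0 //.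
  exact: exprn_ge0.
have [->|u0] := eqVneq `|u 0%N - l| 0; first by rewrite invr0 mulr0 exprn_ge0.
by rewrite ler_pdivrMr // lt_def u0 /=.
Qed.

Lemma is_bigO_geometric u l (b : R) : 0 <= b ->
  (forall t, `|u t - l| <= b ^+ t * `|u 0%N - l|) ->
  is_bigO u l (fun t => b ^+ t).
Proof.
move=> b0 ub.
have bounds t :
    (0 <= `|u t - l|%:E / (b ^+ t)%:E <= `|u 0%N - l|%:E)%E.
  (* When [b ^+ t = 0] the error vanishes too, and the quotient [0 / 0] is 0. *)
  have [bt0|bt0] := eqVneq (b ^+ t) 0.
    have -> : `|u t - l| = 0.
      by apply/eqP; rewrite eq_le normr_ge0 andbT -(mul0r `|u 0%N - l|) -bt0.
    by rewrite mul0e lexx lee_fin /= normr_ge0.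
  have bt : 0 < b ^+ t by rewrite lt_def bt0 exprn_ge0.
  rewrite inver (negbTE bt0) -EFinM !lee_fin divr_ge0 ?(ltW bt) //=.
  by rewrite ler_pdivrMr // mulrC.
have lo : (0 <= limn_esup (fun t => `|u t - l|%:E / (b ^+ t)%:E))%E.
  by apply: limn_esup_ge => t; have /andP[] := bounds t.
have hi : (limn_esup (fun t => `|u t - l|%:E / (b ^+ t)%:E)
    <= `|u 0%N - l|%:E)%E.
  by apply: (@limn_esup_le _ _ _ 0) => t _; have /andP[] := bounds t.
by rewrite /is_bigO ge0_fin_numE // (le_lt_trans hi) // ltry.
Qed.

End Rates.

(** * Exact policy improvement and the stopping test *)

Section Algorithm.
Context {R : realType} {n m : nat}.
Variables (G : robust_game R n m) (epsilon : R).
Hypothesis epsilon_gt0 : 0 < epsilon.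

Local Notation lambda := (discount G).

Implicit Types (d : decision_rule G) (u v : 'cV[R]_m).

Let lambda_ge0 := discount_ge0 G.
Let lambda_lt1 := discount_lt1 G.

(* Clearing the denominator also covers the infinite threshold of
   discount 0. *)
Lemma stopping_testE v u0 :
  stopping_test G epsilon 0 v u0 <->
  2 * lambda * `|u0 - v| < (1 - lambda) * epsilon.
Proof.
have le0 : 0 < (1 - lambda) * epsilon by rewrite mulr_gt0 // subr_gt0.
rewrite /stopping_test sube0 inver.
have [l0|l0] := eqVneq (2 * lambda) 0.
  by rewrite l0 mul0r le0 gt0_muley ?lte_fin // ltry.
have l2 : 0 < 2 * lambda by rewrite lt_def l0 mulr_ge0.
by rewrite -EFinM lte_fin ltr_pdivlMr // mulrC.
Qed.

(** Zero tolerance forces [rho] to be the robust backup. Then [u0] is at once the optimal sweep of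
    [v] and the sweep of the greedy rule [d]. *)
Lemma exact_improvement v u0 d pstar :
  policy_improvement 0 v u0 d pstar ->
  u0 = GS_operator G v /\
  fixpoint (fun k u => robust_backup k (d k) u v) u0.
Proof.
move=> [rho [rhoP _ u0max rhod]].
have {}rhoP k (a : joint_action G) : rho k a = robust_backup k a u0 v.
  by apply/subr0_eq/eqP; rewrite -normr_le0 (le_trans (rhoP k a)) ?mulr0.
have u0P : fixpoint (fun k u => optimal_backup G k u v) u0.
  move=> k; rewrite u0max /optimal_backup; congr set_max.
  by apply: eq_imagel => a _; exact: rhoP.
split=> [|k]; first exact: eq_GS_operator.
rewrite u0max -rhoP; apply: set_max_eq; first by exists (d k).
by move=> _ [a _ <-]; exact: rhod.
Qed.

Lemma exact_improvement_exists v :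
  exists d pstar, policy_improvement 0 v (GS_operator G v) d pstar.
Proof.
set u0 := GS_operator G v.
have /choice[d dP] k := optimal_backup_attained G k u0 v.
have /choice[p pP] (ka : 'I_m * joint_action G) : exists p,
    transitions ka.2 ka.1 p /\
    backup ka.1 ka.2 u0 v p = robust_backup ka.1 ka.2 u0 v.
  by have [p] := robust_backup_attained ka.1 ka.2 u0 v; exists p.
exists d, (fun k a => p (k, a)), (fun k a => robust_backup k a u0 v); split.
- by move=> k a; rewrite subrr normr0 mulr0.
- by move=> k a; exact: (pP (k, a)).
- by move=> k; rewrite (GS_operator_fixpoint G v k).
- by move=> k a; rewrite dP; exact: le_optimal_backup.
Qed.

(* Both the value of [d] and the optimal value are fixed points of discounted
   sweeps that agree with [u0] at [v]. *)
Lemma stopping_value_dist v u0 d pstar :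
  policy_improvement 0 v u0 d pstar -> stopping_test G epsilon 0 v u0 ->
  `|worst_value d - robust_optimal_value G| < epsilon.
Proof.
move=> /exact_improvement[u0E u0d] /stopping_testE stop.
set w := worst_value d; set o := robust_optimal_value G.
have wu : `|w - u0| <= lambda * `|w - v|.
  apply: (fixpoint_dist lambda_ge0 lambda_lt1 (discounted_robust_backup d)) => //.
  exact: worst_value_fixpoint.
have uo : `|u0 - o| <= lambda * `|v - o| by rewrite u0E; exact: GS_operator_dist.
have wv : `|w - v| <= `|w - u0| + `|u0 - v| by exact: ler_distD.
have vo : `|v - o| <= `|u0 - v| + `|u0 - o|.
  by rewrite (distrC u0 v); exact: ler_distD.
have wo : `|w - o| <= `|w - u0| + `|u0 - o| by exact: ler_distD.
have {}wv := ler_wpM2l lambda_ge0 wv; have {}vo := ler_wpM2l lambda_ge0 vo.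
rewrite mulrDr in wv; rewrite mulrDr in vo.
have lambda1 : 0 < 1 - lambda by rewrite subr_gt0.
(* Absorbing terms, [(1 - lambda)|w - u0|] and [(1 - lambda)|u0 - o|] are each at most
   [lambda |u0 - v|]; their sum is below [(1 - lambda) epsilon] by the test. *)
by have := ler_wpM2l (ltW lambda1) wo; rewrite -(ltr_pM2l lambda1); lra.
Qed.

(** * Runs without partial evaluation: existence, correctness, termination *)

Section Run.
Variable M : nat -> nat.
Hypothesis M0 : forall t, M t = 0%N.

(** With [M t = 0] the evaluation loop is empty, so the next iterate is [u0] itself. *)
Lemma step_iterate t v s :
  raTPI_step epsilon 0 M t (Iterate G v) s ->
  exists d pstar, policy_improvement 0 v (GS_operator G v) d pstar /\
    (stopping_test G epsilon 0 v (GS_operator G v) /\ s = Returned d \/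
     ~ stopping_test G epsilon 0 v (GS_operator G v) /\
       s = Iterate G (GS_operator G v)).
Proof.
move E : (Iterate G v) => s0 st.
case: st E => [v' u0 d p imp stop|v' u0 d p u imp go u0E _|//] [->];
  have [GSE _] := exact_improvement imp; exists d, p; rewrite -GSE; split=> //.
  by left.
by right; rewrite M0 u0E.
Qed.

Lemma step_total t (s : raTPI_state G) :
  exists s', raTPI_step epsilon 0 M t s s'.
Proof.
case: s => [v|d]; last by exists (Returned d); constructor.
have [d [p imp]] := exact_improvement_exists v.
have [stop|go] := pselect (stopping_test G epsilon 0 v (GS_operator G v)).
  by exists (Returned d); apply: raTPI_stop imp stop.
exists (Iterate G (GS_operator G v)).
apply: (raTPI_continue (u := fun=> GS_operator G v) imp go erefl).
by move=> j; rewrite M0.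
Qed.

(** Ensures that claims about all runs are not vacuous; the chosen successor depends on the time as
    well as on the state. *)
Lemma run_exists v0 :
  exists x : nat -> raTPI_state G, raTPI_run epsilon 0 M v0 x.
Proof.
have /choice[f fP] (ts : nat * raTPI_state G) := step_total ts.1 ts.2.
pose x := fix x t := if t is t'.+1 then f (t', x t') else Iterate G v0.
by exists x; split=> // t; exact: (fP (t, x t)).
Qed.

Lemma run_iterate v0 (x : nat -> raTPI_state G) t v :
  raTPI_run epsilon 0 M v0 x -> x t = Iterate G v -> v = GS_sequence G v0 t.
Proof.
move=> [x0 xS]; elim: t v => [|t IHt] v; first by rewrite x0 => -[].
have := xS t; case xt : (x t) => [v'|d] st xSt.
  have [d [p [_ [[_]|[_]]]]] := step_iterate st; rewrite xSt // => -[->].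
  by rewrite (IHt _ xt).
by move: st; rewrite xSt => st; inversion st.
Qed.

Lemma run_returned v0 (x : nat -> raTPI_state G) t d :
  raTPI_run epsilon 0 M v0 x -> x t = Returned d ->
  `|worst_value d - robust_optimal_value G| < epsilon.
Proof.
move=> [x0 xS]; elim: t d => [|t IHt] d; first by rewrite x0.
have := xS t; case xt : (x t) => [v|d'] st xSt.
  have [d' [p [imp [[stop]|[_]]]]] := step_iterate st; rewrite xSt // => -[->].
  exact: stopping_value_dist imp stop.
by move: st; rewrite xSt => st; inversion st; subst; exact: IHt.
Qed.

Lemma run_terminates v0 (x : nat -> raTPI_state G) :
  raTPI_run epsilon 0 M v0 x -> exists t d, x t = Returned d.
Proof.
move=> xrun; apply: contrapT => never.
have xE t : x t = Iterate G (GS_sequence G v0 t).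
  case xt : (x t) => [v|d]; last by case: never; exists t, d.
  by rewrite (run_iterate xrun xt).
have go t : ~ stopping_test G epsilon 0
    (GS_sequence G v0 t) (GS_sequence G v0 t.+1).
  by have := xrun.2 t; rewrite !xE => /step_iterate[d [p [_ [[_]|[]]]]].
(* Two consecutive iterates this close to the limit are within 2/5 of [(1 - lambda) epsilon] of each
   other; the factor [2 * lambda] of the test leaves at most 4/5, so the test succeeds. *)
have e0 : 0 < (1 - lambda) * epsilon / 5.
  by rewrite divr_gt0 // mulr_gt0 // subr_gt0.
have /cvgrPdist_lt/(_ _ e0)[N _ NP] := @GS_sequence_cvg _ _ _ G v0.
have h1 := NP N (leqnn N).
have h2 := NP N.+1 (leqnSn N).
apply: (go N); apply/stopping_testE.
rewrite distrC in h2.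
have h3 := ler_distD (robust_optimal_value G)
  (GS_sequence G v0 N.+1) (GS_sequence G v0 N).
have : lambda * `|GS_sequence G v0 N.+1 - GS_sequence G v0 N|
    <= `|GS_sequence G v0 N.+1 - GS_sequence G v0 N|.
  by rewrite ler_piMl // ltW.
rewrite /= in h1 h2 h3 *; lra.
Qed.

End Run.
End Algorithm.

(** * Convergence rates and finite termination combined *)

Theorem theorem1 (R : realType) (n m : nat) (G : robust_game R n m)
    (epsilon delta : R) (M : nat -> nat)
    (epsilon_gt0 : 0 < epsilon)
    (delta_adm : admissible_tolerance G epsilon delta)
    (M0 : forall t, M t = 0%N) (delta0 : delta = 0) :
  (* (a) *)
  [/\ forall (v0 : 'cV[R]_m) x t v,
        raTPI_run epsilon delta M v0 x -> x t = Iterate G v ->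
        v = GS_sequence G v0 t,
      forall v0 : 'cV[R]_m,
        GS_sequence G v0 @ \oo --> robust_optimal_value G,
      forall v0 : 'cV[R]_m,
        converges_at_order 1 (GS_sequence G v0) (robust_optimal_value G) /\
        convergence_rate 1 (GS_sequence G v0) (robust_optimal_value G)
          <= discount G,
      forall v0 : 'cV[R]_m,
        (AARC (GS_sequence G v0) (robust_optimal_value G)
           <= (discount G)%:E)%E
    & exists beta : R, [/\ 0 <= beta, beta <= discount G
        & forall v0 : 'cV[R]_m,
            is_bigO (GS_sequence G v0) (robust_optimal_value G)
              (fun t => beta ^+ t)]]
  /\
  (* (b) *)
  (forall v0 : 'cV[R]_m,
     (exists x : nat -> raTPI_state G, raTPI_run epsilon delta M v0 x) /\
     forall x : nat -> raTPI_state G, raTPI_run epsilon delta M v0 x ->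
       exists t d,
         [/\ x t = Returned d,
             robust_team_optimal epsilon d
           & `|worst_value d - robust_optimal_value G| < epsilon]).
Proof.
subst delta; split; last first.
  move=> v0; split; first exact: run_exists.
  move=> x xrun; have [t [d xt]] := run_terminates epsilon_gt0 M0 xrun.
  have dist := run_returned epsilon_gt0 M0 xrun xt.
  exists t, d; split=> // k; rewrite lerBlDr.
  apply: le_trans (le_coord_dist _ (worst_value d) k) _.
  by rewrite lerD2l distrC ltW.
have lambda_ge0 := discount_ge0 G.
split.
- by move=> v0 x t v; exact: run_iterate.
- exact: GS_sequence_cvg.
- move=> v0.
  have rate : order_constants 1 (GS_sequence G v0) (robust_optimal_value G)
      (discount G).
    by split=> // t; rewrite powRr1 //; exact: GS_operator_dist.
  split; last exact: convergence_rate_le.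
  by split; [|exact: GS_sequence_cvg|exists (discount G)].
- by move=> v0; apply: AARC_le => // t; exact: GS_sequence_dist.
- exists (discount G); split=> // v0.
  by apply: is_bigO_geometric => // t; exact: GS_sequence_dist.
Qed.
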